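(* Let $M\in\mathbb{C}^{n\times n}$ satisfy $\mathrm{Ind}(M)\le 1$, let $r=\mathrm{rk}(M)$, and let $b\in\mathbb{C}^n$. Let $L\in\mathbb{C}^{n\times(n-r)}$ with $\mathrm{rk}(L)=n-r$ and $\mathcal{R}(L)=\mathcal{N}(M^\ast)$. Then the problem $$\|Mx-b\|_F=\min\quad\text{subject to}\quad x\in\mathcal{R}(M)$$ has the unique solution $x=(x_1,x_2,\ldots,x_n)^T$ satisfying $$x_i=\frac{\det\left(\begin{bmatrix} M(i\to b) & L\\ L^\ast(i\to 0) & 0\end{bmatrix}\right)}{\det\left(\begin{bmatrix} M & L\\ L^\ast & 0\end{bmatrix}\right)},\qquad i=1,2,\ldots,n$$ (in particular, the determinant in the denominator is nonzero).
   Context: $\mathcal{R}(\cdot)$ and $\mathcal{N}(\cdot)$ denote range (column space) and null space, $^\ast$ the conjugate transpose, and $\|\cdot\|_F$ the Frobenius norm (for a vector, the Euclidean norm). For a matrix $A$ and a column vector $c$ of matching length, $A(i\to c)$ denotes the matrix obtained from $A$ by replacing its $i$-th column by $c$; so $L^\ast(i\to 0)$ is $L^\ast$ with its $i$-th column replaced by the zero vector. The index $\mathrm{Ind}(M)$ of a singular $M\in\mathbb{C}^{n\times n}$ is the smallest positive integer $k$ with $\mathrm{rk}(M^{k+1})=\mathrm{rk}(M^k)$; the index of a nonsingular matrix is $0$. A solution of the problem is a vector $x\in\mathcal{R}(M)$ minimizing $\|Mz-b\|_F$ over all $z\in\mathcal{R}(M)$. *)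

(* Defs.v *)
From mathcomp Require Import all_boot all_order all_algebra.
From mathcomp Require Import sesquilinear spectral complex.
From mathcomp Require Import classical_sets reals.

Set Implicit Arguments.
Unset Strict Implicit.
Unset Printing Implicit Defensive.

Import Order.TTheory GRing.Theory Num.Theory.
(* M ^t* is the conjugate transpose of M, from spectral. *)
Export sesquilinear spectral complex classical_sets reals.
Global Open Scope ring_scope.
Global Open Scope sesquilinear_scope.

(* Vectors are columns here, whereas mxalgebra's (_ <= _)%MS is about row
   spaces. *)
Definition colspace (F : fieldType) m n (A : 'M[F]_(m, n)) : set 'cV[F]_m :=
  range (fun y : 'cV[F]_n => A *m y).

Definition nullspace (F : fieldType) m n (A : 'M[F]_(m, n)) : set 'cV[F]_n :=
  [set x : 'cV[F]_n | A *m x = 0].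

Definition replace_col (F : fieldType) m n (A : 'M[F]_(m, n)) (i : 'I_n)
    (c : 'cV[F]_m) : 'M[F]_(m, n) :=
  \matrix_(k, l) if l == i then c k 0 else A k l.

(* The values are nonnegative reals seen in C, where <= restricts to the usual
   order on the reals. *)
Definition frobenius_norm (C : numClosedFieldType) m n (A : 'M[C]_(m, n)) : C :=
  sqrtC (\sum_i \sum_j `|A i j| ^+ 2).

Lemma mxrank_exp_stationary (F : fieldType) n (M : 'M[F]_n) :
  exists k, (0 < k)%N && (\rank (M ^+ k.+1) == \rank (M ^+ k)).
Proof.
have le_rk k : (\rank (M ^+ k.+1) <= \rank (M ^+ k))%N.
  by rewrite exprS -mulmxE mxrankM_maxr.
have aux d : forall k, (0 < k)%N -> (\rank (M ^+ k) <= d)%N ->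
    exists j, (0 < j)%N && (\rank (M ^+ j.+1) == \rank (M ^+ j)).
  elim: d => [|d IHd] k k_gt0 rkd.
    exists k; rewrite k_gt0 eqn_leq le_rk.
    by move: rkd; rewrite leqn0 => /eqP->.
  have [eq_rk|ne_rk] := boolP (\rank (M ^+ k.+1) == \rank (M ^+ k)).
    by exists k; rewrite k_gt0.
  apply: (IHd k.+1) => //; rewrite -ltnS; apply: leq_trans rkd.
  by rewrite ltn_neqAle ne_rk le_rk.
exact: (aux n 1%N isT (rank_leq_row _)).
Qed.

Definition mxindex (F : fieldType) n (M : 'M[F]_n) : nat :=
  if M \in unitmx then 0%N else ex_minn (mxrank_exp_stationary M).

Definition is_range_constrained_lsq (C : numClosedFieldType) n (M : 'M[C]_n)
    (b x : 'cV[C]_n) : Prop :=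
  colspace M x /\
  forall z, colspace M z ->
    frobenius_norm (M *m x - b) <= frobenius_norm (M *m z - b).

(* Main.v *)
Require Import Defs.
From mathcomp Require Import all_boot all_order all_algebra.

Set Implicit Arguments.
Unset Strict Implicit.
Unset Printing Implicit Defensive.

Import Order.TTheory GRing.Theory Num.Theory.

(** The bordered matrix K = [M L; L^* 0] encodes the optimality conditions of
    the constrained problem. Since the columns of L form a basis of N(M^* ),
    the orthogonal complement of R(M), the equation L^* x = 0 says exactly that
    x lies in R(M), and the equation M x + L y = b says that the residual
    M x - b = - L y is orthogonal to R(M). By Pythagoras, a solution (x, y) of
    K (x, y) = (b, 0) therefore gives a minimizer
    ([range_constrained_lsq_of_bordered]).

    The index hypothesis enters through rk(M^2) = rk(M), that is, M is injective
    on R(M) ([index_le1_inj_range]). It makes K nonsingular ([bordered_unit]):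
    if M x + L y = 0 and L^* x = 0, then M x and L y are orthogonal, hence both
    zero, so y = 0 because L has full column rank, and x = 0 because x is in
    R(M). It also makes the minimizer unique, as two minimizers have the same
    image under M. The formula for the entries of x is then Cramer's rule for
    K (x, y) = (b, 0) ([cramer_rule]). *)

(** * Ranges, null spaces and Cramer's rule over a field *)

Section Field.

Variable F : fieldType.

(** Exactness follows from a dimension count: A *m B = 0 puts the range of B
    inside the null space of A, and the two dimensions agree. *)
Lemma nullspace_sub_colspace m n p (A : 'M[F]_(m, n)) (B : 'M[F]_(n, p)) x :
  A *m B = 0 -> (n <= \rank A + \rank B)%N -> A *m x = 0 -> colspace B x.
Proof.
move=> AB0 rkAB Ax0.
have sBA : (B^T <= kermx A^T)%MS by apply/sub_kermxP; rewrite -trmx_mul AB0 trmx0.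
have rkBA : (\rank (kermx A^T) <= \rank B^T)%N.
  by rewrite mxrank_ker !mxrank_tr leq_subLR.
have sAB : (kermx A^T <= B^T)%MS by rewrite -(geq_leqif (mxrank_leqif_sup sBA)).
have /submxP[D xD] : (x^T <= B^T)%MS.
  apply: submx_trans sAB; apply/sub_kermxP.
  by rewrite -trmx_mul Ax0 trmx0.
exists D^T => //=; apply: trmx_inj.
by rewrite trmx_mul trmxK xD.
Qed.

(** Left multiplication by A preserves the dimension of the range of B, so it
    is injective there. *)
Lemma mulmx_inj_on_colspace m n p (A : 'M[F]_(m, n)) (B : 'M[F]_(n, p)) x :
  \rank (A *m B) = \rank B -> colspace B x -> A *m x = 0 -> x = 0.
Proof.
move=> rkAB [y _ <-] ABy0.
have sBAB : (kermx B^T <= kermx (A *m B)^T)%MS.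
  by apply/sub_kermxP; rewrite trmx_mul mulmxA mulmx_ker mul0mx.
have sABB : (kermx (A *m B)^T <= kermx B^T)%MS.
  rewrite -(geq_leqif (mxrank_leqif_sup sBAB)).
  by rewrite !mxrank_ker !mxrank_tr rkAB.
have : (y^T <= kermx B^T)%MS.
  apply: submx_trans sABB; apply/sub_kermxP.
  by rewrite -trmx_mul -mulmxA ABy0 trmx0.
by move/sub_kermxP; rewrite -trmx_mul => /(congr1 trmx); rewrite trmxK trmx0.
Qed.

Lemma rank_sqr_index_le1 n (M : 'M[F]_n) :
  (mxindex M <= 1)%N -> \rank (M *m M) = \rank M.
Proof.
rewrite /mxindex; case: ifP => [M_unit _|_].
  by rewrite mxrankMfree // row_free_unit.
case: ex_minnP => k /andP[k_gt0 /eqP rkM] _ k_le1.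
have k1 : k = 1%N by apply/eqP; rewrite eqn_leq k_le1.
by move: rkM; rewrite k1 expr1 expr2 mulmxE.
Qed.

Lemma index_le1_inj_range n (M : 'M[F]_n) (x : 'cV[F]_n) :
  (mxindex M <= 1)%N -> colspace M x -> M *m x = 0 -> x = 0.
Proof. by move=> /rank_sqr_index_le1; apply: mulmx_inj_on_colspace. Qed.

Lemma unitmx_inj n (A : 'M[F]_n) :
  (forall x : 'cV[F]_n, A *m x = 0 -> x = 0) -> A \in unitmx.
Proof.
move=> injA; rewrite unitmxE unitfE -det_tr; apply/det0P => -[v v_neq0 vA0].
have v0 : v^T = 0 by apply: injA; rewrite -[A]trmxK -trmx_mul vA0 trmx0.
by move: v_neq0; rewrite -[v]trmxK v0 trmx0 eqxx.
Qed.

Lemma cofactor_replace_col n (A : 'M[F]_n) j c k :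
  cofactor (replace_col A j c) k j = cofactor A k j.
Proof.
rewrite /cofactor; congr (_ * \det _).
by apply/matrixP => p q; rewrite !mxE [lift j q == j]eq_sym (negPf (neq_lift _ _)).
Qed.

Lemma cramer_rule n (A : 'M[F]_n) (x c : 'cV[F]_n) (j : 'I_n) :
  \det A != 0 -> A *m x = c -> x j 0 = \det (replace_col A j c) / \det A.
Proof.
move=> detA Axc; apply: (mulIf detA); rewrite divfK // mulrC.
have -> : \det A * x j 0 = (\adj A *m c) j 0.
  by rewrite -Axc mulmxA mul_adj_mx mul_scalar_mx mxE.
(* Laplace expansion along the replaced column gives the same sum, because
     the cofactors of that column do not see its entries. *)
  rewrite (expand_det_col _ j) mxE; apply: eq_bigr => k _.
by rewrite cofactor_replace_col !mxE eqxx mulrC.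
Qed.

Lemma replace_col_block n p m q (A : 'M[F]_(n, p)) (B : 'M[F]_(n, q))
    (C : 'M[F]_(m, p)) (D : 'M[F]_(m, q)) (i : 'I_p) c d :
  replace_col (block_mx A B C D) (lshift q i) (col_mx c d) =
  block_mx (replace_col A i c) B (replace_col C i d) D.
Proof.
apply/matrixP => k l; rewrite mxE.
case: (split_ordP k) => k' ->; case: (split_ordP l) => l' ->;
  rewrite ?block_mxEul ?block_mxEur ?block_mxEdl ?block_mxEdr ?mxE
          ?(inj_eq (@lshift_inj _ _)) ?eq_rlshift //.
- by rewrite (unsplitK (inl _)).
- by rewrite (unsplitK (inr _)).
Qed.

End Field.

(** * Frobenius norm and orthogonality *)

Section Bordered.

Variable C : numClosedFieldType.

Lemma frobenius_norm_ge0 m n (A : 'M[C]_(m, n)) : 0 <= frobenius_norm A.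
Proof.
rewrite sqrtC_ge0; apply: sumr_ge0 => i _; apply: sumr_ge0 => j _.
exact: exprn_ge0.
Qed.

Lemma sqr_frobenius_norm m n (A : 'M[C]_(m, n)) :
  frobenius_norm A ^+ 2 = \tr (A ^t* *m A).
Proof.
rewrite sqrtCK exchange_big; apply: eq_bigr => j _; rewrite mxE.
by apply: eq_bigr => i _; rewrite !mxE normCKC.
Qed.

Lemma frobenius_norm0_eq0 m n (A : 'M[C]_(m, n)) : frobenius_norm A = 0 -> A = 0.
Proof.
have norm_ge0 i j : 0 <= `|A i j| ^+ 2 by apply: exprn_ge0.
move=> /eqP; rewrite sqrtC_eq0 => /eqP A0; apply/matrixP => i j; rewrite mxE.
have Ai0 : \sum_j `|A i j| ^+ 2 = 0.
  by apply: (psumr_eq0P _ A0) => // k _; apply: sumr_ge0.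
have /eqP : `|A i j| ^+ 2 = 0 by apply: (psumr_eq0P _ Ai0).
by rewrite sqrf_eq0 normr_eq0 => /eqP.
Qed.

Lemma trmxC_mul m n p (A : 'M[C]_(m, n)) (B : 'M[C]_(n, p)) :
  (A *m B) ^t* = B ^t* *m A ^t*.
Proof. by rewrite trmx_mul map_mxM. Qed.

Lemma trmxC_mul_eq0C m n p (A : 'M[C]_(n, m)) (B : 'M[C]_(n, p)) :
  A ^t* *m B = 0 -> B ^t* *m A = 0.
Proof. by move=> AB0; rewrite -[A]trmxCK -trmxC_mul AB0 trmx0 map_mx0. Qed.

Lemma pythagoras m n (A B : 'M[C]_(m, n)) :
  A ^t* *m B = 0 ->
  frobenius_norm (A + B) ^+ 2 = frobenius_norm A ^+ 2 + frobenius_norm B ^+ 2.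
Proof.
move=> AB0; rewrite !sqr_frobenius_norm [(A + B)^T]linearD map_mxD mulmxDl !mulmxDr.
by rewrite AB0 (trmxC_mul_eq0C AB0) addr0 add0r mxtraceD.
Qed.

Lemma orthogonal_add_eq0 m n (A B : 'M[C]_(m, n)) :
  A ^t* *m B = 0 -> A + B = 0 -> A = 0.
Proof.
move=> AB0 /eqP; rewrite addr_eq0 => /eqP AB; apply: frobenius_norm0_eq0.
apply/eqP; rewrite -sqrf_eq0 sqr_frobenius_norm {2}AB mulmxN AB0 oppr0.
by rewrite mxtrace0.
Qed.

(** * The bordered matrix *)

Section Problem.

Variables (n p : nat) (M : 'M[C]_n) (L : 'M[C]_(n, p)).
Hypothesis rkL : \rank L = p.
Hypothesis rkML : (\rank M + p)%N = n.
Hypothesis rangeL : colspace L = nullspace (M ^t*).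

Let K := block_mx M L (L ^t*) 0.

Lemma border_orthogonal : M ^t* *m L = 0.
Proof.
apply/matrixP => i j.
have : nullspace (M ^t*) (col j L).
  by rewrite -rangeL; exists (delta_mx j 0); rewrite // -colE.
by rewrite /nullspace /= colE mulmxA -colE => /matrixP/(_ i 0); rewrite !mxE.
Qed.

(** R(M) lies in N(L^* ) by orthogonality, and both have dimension n - p. *)
Lemma border_ker_range (x : 'cV[C]_n) : L ^t* *m x = 0 -> colspace M x.
Proof.
apply: nullspace_sub_colspace; first exact: trmxC_mul_eq0C border_orthogonal.
by rewrite mxrank_map mxrank_tr rkL addnC rkML.
Qed.

Lemma border_inj (y : 'cV[C]_p) : L *m y = 0 -> y = 0.
Proof.
move=> Ly0; apply/(@mulmx_inj_on_colspace _ _ _ _ L 1%:M) => //.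
  by rewrite mulmx1 mxrank1.
by exists y; rewrite ?mul1mx.
Qed.

Lemma range_border_orthogonal (z : 'cV[C]_n) (y : 'cV[C]_p) :
  (M *m z) ^t* *m (L *m y) = 0.
Proof.
by rewrite trmxC_mul -mulmxA (mulmxA _ L) border_orthogonal mul0mx mulmx0.
Qed.

(** In a kernel vector (x, y), M x and L y are orthogonal with sum zero, so both
    vanish. *)
Lemma bordered_unit : (mxindex M <= 1)%N -> K \in unitmx.
Proof.
move=> indM; apply: unitmx_inj => v.
rewrite -[v]vsubmxK mul_block_col mul0mx addr0 -[RHS]col_mx0.
set x := usubmx v; set y := dsubmx v => /eq_col_mx[MxLy0 Lx0].
have Mx0 : M *m x = 0.
  exact: orthogonal_add_eq0 (range_border_orthogonal x y) MxLy0.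
have -> : y = 0 by apply: border_inj; rewrite Mx0 add0r in MxLy0.
have -> : x = 0 by apply: index_le1_inj_range (border_ker_range Lx0) Mx0.
by rewrite col_mx0.
Qed.

(** M z - b is the sum of M (z - x), which lies in R(M), and of the residual
    - L y of x, which is orthogonal to R(M). *)
Lemma residual_pythagoras (b x z : 'cV[C]_n) (y : 'cV[C]_p) :
  M *m x + L *m y = b ->
  frobenius_norm (M *m z - b) ^+ 2 =
  frobenius_norm (M *m (z - x)) ^+ 2 + frobenius_norm (M *m x - b) ^+ 2.
Proof.
move=> Mxy; have res_x : M *m x - b = L *m - y.
  by rewrite -Mxy opprD addNKr mulmxN.
rewrite -pythagoras; last by rewrite res_x; apply: range_border_orthogonal.
by rewrite mulmxBr addrA subrK.
Qed.

(** Pythagoras shows at once that x is a minimizer, and that for any other one,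
    z, the excess term M (z - x) vanishes; as z - x is in R(M), where M is
    injective, z = x. *)
Lemma range_constrained_lsq_of_bordered (b x : 'cV[C]_n) (y : 'cV[C]_p) :
  (mxindex M <= 1)%N -> K *m col_mx x y = col_mx b 0 ->
  unique (is_range_constrained_lsq M b) x.
Proof.
rewrite mul_block_col mul0mx addr0 => indM /eq_col_mx[Mxy Lx0].
have xM := border_ker_range Lx0.
have norm_ge0 := frobenius_norm_ge0.
split=> [|z [zM z_min]].
  split=> // z _; rewrite -(@ler_pXn2r _ 2) ?nnegrE //.
  by rewrite (residual_pythagoras z Mxy) lerDr exprn_ge0.
apply/eqP; rewrite eq_sym -subr_eq0; apply/eqP; apply: index_le1_inj_range indM _ _.
  case: zM xM => [u _ <-] [v _ <-].
  by exists (u - v); rewrite // mulmxBr.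
apply: frobenius_norm0_eq0; apply/eqP; rewrite -sqrf_eq0 eq_le exprn_ge0 // andbT.
have := z_min _ xM; rewrite -(@ler_pXn2r _ 2) ?nnegrE //.
by rewrite (residual_pythagoras z Mxy) gerDr.
Qed.

End Problem.

End Bordered.

Theorem theorem3p4 (R : realType) (n r : nat) (M : 'M[R[i]]_n)
    (b : 'cV[R[i]]_n) (L : 'M[R[i]]_(n, n - r)) :
  (mxindex M <= 1)%N ->
  r = \rank M ->
  \rank L = (n - r)%N ->
  colspace L = nullspace (M ^t*) ->
  \det (block_mx M L (L ^t*) 0) != 0 /\
  exists x : 'cV[R[i]]_n,
    unique (is_range_constrained_lsq M b) x /\
    forall i : 'I_n,
      x i 0 = \det (block_mx (replace_col M i b) L
                             (replace_col (L ^t*) i 0) 0)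
              / \det (block_mx M L (L ^t*) 0).
Proof.
move=> indM def_r rkL rangeL.
have rkML : (\rank M + (n - r))%N = n.
  by rewrite -def_r subnKC // def_r rank_leq_row.
have K_unit := bordered_unit rkL rkML rangeL indM.
have detK : \det (block_mx M L (L ^t*) 0) != 0 by rewrite -unitfE -unitmxE.
split=> //.
pose v := invmx (block_mx M L (L ^t*) 0) *m col_mx b 0.
have Kv : block_mx M L (L ^t*) 0 *m v = col_mx b 0 by rewrite mulKVmx.
exists (usubmx v); split=> [|i].
  apply: (range_constrained_lsq_of_bordered rkL rkML rangeL (y := dsubmx v) indM).
  by rewrite vsubmxK.
by rewrite mxE (cramer_rule (lshift _ i) detK Kv) replace_col_block.
Qed.
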